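(* Let $\delta > 0$ and put $\epsilon = \delta/100$. Then there exists $n_0$ such that the following holds for all $n \ge n_0$. Every cancellative $3$-graph $H$ on the vertex set $[n]$ with at least $(1-\epsilon)\,t_3(n,3)$ edges has a partition of its vertex set $[n] = V_1 \cup V_2 \cup V_3$ such that all but at most $\delta n^3$ edges of $H$ have exactly one vertex in each $V_i$.
   Context: A $3$-graph on $[n]=\{1,\dots,n\}$ is a set of $3$-element subsets of $[n]$, called edges. A hypergraph is cancellative if it does not contain three distinct edges $A,B,C$ with $A \triangle B \subset C$, where $\triangle$ denotes symmetric difference and $\subset$ means contained in. The number $t_3(n,3)$ is the number of $3$-subsets of $[n]$ meeting each part of a partition $U_1\cup U_2\cup U_3$ of $[n]$ in at most one vertex, where every part has size $\lfloor n/3\rfloor$ or $\lceil n/3\rceil$. Parts of the partition $V_1\cup V_2\cup V_3$ in the claim are allowed to be empty. *)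

(* Defs.v *)
From mathcomp Require Import all_boot all_order all_algebra.
From mathcomp Require Import reals.
From mathcomp Require Import zify.

Set Implicit Arguments.
Unset Strict Implicit.
Unset Printing Implicit Defensive.

(* The vertex set [n] is 'I_n; hypergraphs on T are elements of {set {set T}}. *)

Definition three_graph (T : finType) (H : {set {set T}}) : Prop :=
  forall A, A \in H -> #|A| = 3.

Definition symdiff (T : finType) (A B : {set T}) : {set T} :=
  (A :\: B) :|: (B :\: A).

Definition cancellative (T : finType) (H : {set {set T}}) : Prop :=
  forall A B C, A \in H -> B \in H -> C \in H ->
    A != B -> A != C -> B != C -> ~~ (symdiff A B \subset C).

(* Unlike finset's [partition], this is an indexed family and allows empty
   parts. *)
Definition tripartition (T : finType) (V : 'I_3 -> {set T}) : Prop :=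
  (forall i j, i != j -> [disjoint V i & V j]) /\ \bigcup_i V i = [set: T].

(* n.+2 %/ 3 is the ceiling of n/3. *)
Definition balanced (T : finType) (V : 'I_3 -> {set T}) : Prop :=
  forall i, #|V i| = #|T| %/ 3 \/ #|V i| = #|T|.+2 %/ 3.

Definition partial_transversals (T : finType) (V : 'I_3 -> {set T}) :
    {set {set T}} :=
  [set e : {set T} | (#|e| == 3) && [forall i, #|e :&: V i| <= 1]].

Definition residue_parts (n : nat) (i : 'I_3) : {set 'I_n} :=
  [set x : 'I_n | x %% 3 == i].

(* The partition by residues mod 3 is one balanced tripartition of 'I_n
   ([residue_parts_tripartition], [residue_parts_balanced]); every other one
   gives the same number ([t3E]). *)
Definition t3 (n : nat) : nat := #|partial_transversals (@residue_parts n)|.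

Definition noncrossing (T : finType) (V : 'I_3 -> {set T}) (H : {set {set T}}) :
    {set {set T}} :=
  [set e in H | ~~ [forall i, #|e :&: V i| == 1]].

Lemma residue_parts_tripartition n : tripartition (@residue_parts n).
Proof.
split=> [i j nij|].
  rewrite -setI_eq0; apply/eqP/setP=> x; rewrite !inE.
  apply/negbTE; apply: contra nij => /andP[/eqP xi /eqP xj].
  by apply/eqP/val_inj; rewrite /= -xi.
apply/setP=> x; rewrite inE; apply/bigcupP.
by exists (Ordinal (ltn_pmod x (isT : 0 < 3))); rewrite ?inE.
Qed.

Lemma residue_parts_balanced n : balanced (@residue_parts n).
Proof.
move=> i; rewrite card_ord.
have -> : #|residue_parts n i| = (n + 2 - i) %/ 3.
  rewrite cardsE -sum1_card.
  have i3 := ltn_ord i.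
  rewrite -(big_mkord (fun x => x %% 3 == i) (fun=> 1)).
  elim: n => [|n IHn]; first by rewrite big_geq //; lia.
  rewrite big_mkcond big_nat_recr //= -big_mkcond IHn.
  by case: eqP; lia.
by have := ltn_ord i; lia.
Qed.

Lemma card_tripartitionI (T : finType) (V : 'I_3 -> {set T}) (A : {set T}) :
  tripartition V -> \sum_i #|A :&: V i| = #|A|.
Proof.
move=> [dV cV].
have {2}-> : A = \bigcup_i (A :&: V i) by rewrite -big_distrr /= cV setIT.
rewrite -sum1_card partition_disjoint_bigcup /=; last first.
  move=> i j /dV dij; apply: disjointWl (subsetIr _ _) _.
  by apply: disjointWr (subsetIr _ _) _.
by apply: eq_bigr => i _; rewrite sum1_card.
Qed.

Lemma card_tripartition (T : finType) (V : 'I_3 -> {set T}) :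
  tripartition V -> \sum_i #|V i| = #|T|.
Proof.
move=> tV; rewrite -cardsT -(card_tripartitionI [set: T] tV).
by apply: eq_bigr => i _; rewrite setTI.
Qed.

Lemma partial_transversal_crossing (T : finType) (V : 'I_3 -> {set T}) e :
  tripartition V -> e \in partial_transversals V -> forall i, #|e :&: V i| = 1.
Proof.
move=> tV; rewrite inE => /andP[/eqP e3 /forallP e1].
have := card_tripartitionI e tV; rewrite e3.
have leq3 : \sum_(i < 3) 1 = 3 by rewrite sum1_card card_ord.
move=> sE i; apply/eqP; move: i.
have /leqif_sum : forall i : 'I_3, true -> #|e :&: V i| <= 1 ?= iff (#|e :&: V i| == 1).
  by move=> i _; split.
by rewrite sE leq3 => -[_]; rewrite eqxx => /esym/forallP.
Qed.

Lemma card_partial_transversals (T : finType) (V : 'I_3 -> {set T}) :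
  tripartition V -> #|partial_transversals V| = \prod_i #|V i|.
Proof.
move=> tV; have [dV _] := tV.
have VI i j x : x \in V i -> x \in V j -> i = j.
  move=> xi xj; apply/eqP; apply: contraT => /dV /pred0P/(_ x) /=.
  by rewrite xi xj.
pose F (f : {ffun 'I_3 -> T}) := [set f i | i : 'I_3].
pose W := family (fun i => mem (V i)).
have Winj : {in W &, injective F}.
  move=> f g /familyP fV /familyP gV eFG; apply/ffunP=> i.
  have: f i \in F g by rewrite -eFG; apply: imset_f.
  case/imsetP=> j _ fg; rewrite fg; congr (g _); apply/esym.
  by apply: VI (fV i) _; rewrite fg; apply: gV.
have FV f i : f \in W -> F f :&: V i = [set f i].
  move=> /familyP fV; apply/setP=> x; rewrite !inE; apply/andP/eqP => [[]|->].
    by case/imsetP=> j _ -> fj; congr (f _); apply: VI (fV j) fj.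
  by split; [apply: imset_f | apply: fV].
have -> : partial_transversals V = F @: W.
  apply/setP=> e; apply/idP/imsetP => [eP|[f fW ->]].
    have e1 := partial_transversal_crossing tV eP.
    have /fin_all_exists[f fE] i : exists x, e :&: V i = [set x].
      by apply/cards1P; rewrite e1.
    have fi i : f i \in e :&: V i by rewrite fE set11.
    exists (finfun f).
      by apply/familyP=> i; rewrite ffunE; have /setIP[] := fi i.
    apply/esym/eqP; rewrite eqEcard; apply/andP; split.
      by apply/subsetP=> x /imsetP[i _ ->]; rewrite ffunE; have /setIP[] := fi i.
    move: eP; rewrite inE => /andP[/eqP-> _].
    rewrite card_imset ?card_ord // => i j; rewrite !ffunE => fij.
    have /setIP[_ fVi] := fi i; have /setIP[_ fVj] := fi j.
    by apply: VI fVi _; rewrite fij.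
  rewrite inE -(card_tripartitionI _ tV); apply/andP; split.
    rewrite (eq_bigr (fun=> 1)) ?sum1_card ?card_ord // => i _.
    by rewrite FV // cards1.
  by apply/forallP=> i; rewrite FV // cards1.
by rewrite card_in_imset // card_family foldrE big_map big_enum.
Qed.

Lemma t3E n (U : 'I_3 -> {set 'I_n}) :
  tripartition U -> balanced U -> #|partial_transversals U| = t3 n.
Proof.
move=> tU bU; rewrite /t3 !card_partial_transversals //;
  last exact: residue_parts_tripartition.
have := card_tripartition tU.
have := card_tripartition (residue_parts_tripartition n).
have bR := @residue_parts_balanced n.
rewrite !big_ord_recl !big_ord0 !card_ord !addn0 !muln1.
move: (bU ord0) (bU (lift ord0 ord0)) (bU (lift ord0 (lift ord0 ord0))).
move: (bR ord0) (bR (lift ord0 ord0)) (bR (lift ord0 (lift ord0 ord0))).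
rewrite !card_ord.
do 3![move: #|residue_parts _ _| => ?]; do 3![move: #|U _| => ?].
have [k /or3P[]/eqP ->] : exists k, [|| n == 3 * k, n == (3 * k).+1 | n == (3 * k).+2].
- by exists (n %/ 3); lia.
- have -> : (3 * k) %/ 3 = k by lia.
  have -> : (3 * k).+2 %/ 3 = k by lia.
  by do 6![case=> ->].
- have -> : (3 * k).+1 %/ 3 = k by lia.
  have -> : (3 * k).+3 %/ 3 = k.+1 by lia.
  by do 6![case=> ->] => *; nia.
- have -> : (3 * k).+2 %/ 3 = k by lia.
  have -> : (3 * k).+4 %/ 3 = k.+1 by lia.
  by do 6![case=> ->] => *; nia.
Qed.

(* Main.v *)
Require Import Defs.
From mathcomp Require Import all_boot all_order all_algebra.
From mathcomp Require Import reals.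
From mathcomp Require Import zify lra.

(** Call a pair of vertices covered if some edge contains it.  Everything rests
    on one consequence of cancellativity ([cancel_triples]): if xuv and yuv are
    edges, then xy is not covered.  It has two uses.

    - The links of the vertices of a clique of covered pairs are edge-disjoint,
      and the union of these links consists of covered pairs.
    - The common neighbourhood N(xy) = {z : xyz is an edge} meets every edge in
      at most one vertex; for an edge xyz the sets N(xy), N(yz), N(zx) are
      pairwise disjoint.

    Suppose first that, on m vertices, every link has more than m^2 / 10 edges.
    Five pairwise covered vertices would have more than m^2 / 2 edges in their
    links, so there are none; by Turan's theorem at most 3 m^2 / 8 pairs are
    covered.  Four pairwise covered vertices would now give more than
    4 m^2 / 10 covered pairs, so there are none either, and a second use of
    Turan's theorem leaves at most m^2 / 3 covered pairs ([shadow_bound]).  With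
    so few pairs to share the edges, by Cauchy-Schwarz some edge xyz satisfies
    |N(xy)| + |N(yz)| + |N(zx)| >= 27 e / m^2, where e is the number of edges
    ([heavy_edge]).  These three sets are the wanted parts, up to the vertices
    they miss.

    In general, vertices with a small link are deleted one by one
    ([dense_core]).  Going from n to m vertices costs about (n^3 - m^3) / 30
    edges, less than the (n^3 - m^3) / 27 that the extremal bound loses, so a
    graph with (1 - eps) n^3 / 27 edges keeps enough of them, and the three sets
    miss at most 10 eps n + O(1) vertices.  Each edge that is not crossing
    contains a missed vertex, so there are at most 10 eps n^3 + O(n^2) such
    edges.

    Counts are made over ordered pairs and triples, hence are 2 or 6 times the
    numbers above. *)

Set Implicit Arguments.
Unset Strict Implicit.
Unset Printing Implicit Defensive.

(** * Turan's theorem and Cauchy-Schwarz *)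

Definition clique (T : finType) (e : rel T) (K : {set T}) :=
  forall x y, x \in K -> y \in K -> x != y -> e x y.

(** The difference of the two sides, after multiplication by r + 1, is at least
    (d - (r + 1) q)^2. *)
Lemma turan_step r d q a b c :
  r.+1 * c <= r * d ^ 2 -> b <= q * d -> a <= c + b ->
  r.+2 * (a + b) <= r.+1 * (d + q) ^ 2.
Proof.
move=> hc hb ha; rewrite -(leq_pmul2l (ltn0Sn r)).
have [hsq _] := nat_Cauchy d (r.+1 * q).
apply: (@leq_trans (r.+2 * (r * d ^ 2 + 2 * (r.+1 * (q * d))))).
  rewrite mulnCA leq_mul2l; apply/orP; right.
  by have : r.+1 * b <= r.+1 * (q * d) by [rewrite leq_mul2l hb orbT]; nia.
by move: hsq; nia.
Qed.

(** Turan's bound on twice the number of edges of a graph without K_(r+2),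
    by induction on r.  The neighbourhood A of a vertex of maximum degree d has
    no K_(r+1); each edge not inside A has an end outside A, and there are
    |S| - d vertices outside A, of degree at most d. *)
Lemma turan (T : finType) (e : rel T) r (S : {set T}) : symmetric e -> irreflexive e ->
    (forall K : {set T}, K \subset S -> clique e K -> #|K| = r.+2 -> False) ->
  r.+1 * (\sum_(x in S) \sum_(y in S) e x y) <= r * #|S| ^ 2.
Proof.
move=> esym eirr; elim: r S => [|r IHr] S freeS.
  rewrite mul0n mul1n leqn0; apply/eqP/big1 => x xS; apply: big1 => y yS.
  case exy: (e x y) => //; exfalso; apply: (freeS [set x; y]).
  - by apply/subsetP=> z; rewrite !inE => /orP[]/eqP->.
  - move=> a b; rewrite !inE => /orP[]/eqP-> /orP[]/eqP->; rewrite ?eqxx // => _.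
    by rewrite esym.
  - by rewrite cards2; case: eqP => // xy; move: exy; rewrite xy eirr.
have [->|[x0 x0S]] := set_0Vmem S; first by rewrite big_set0 muln0.
pose deg x := \sum_(y in S) e x y.
have [x xS xmax] : exists2 x, x \in S & forall y, y \in S -> deg y <= deg x.
  by case: (arg_maxnP deg x0S) => x xS xm; exists x.
pose A := [set y in S | e x y].
have cardA : #|A| = deg x.
  rewrite -sum1_card /deg big_mkcond [RHS]big_mkcond; apply: eq_bigr => y _.
  by rewrite inE; case: (y \in S) => //=; case: (e x y).
have AS : A \subset S by apply/subsetP=> y; rewrite inE => /andP[].
have IHA : r.+1 * (\sum_(y in A) \sum_(z in A) e y z) <= r * deg x ^ 2.
  rewrite -cardA; apply: IHr => K KA Kc cK.
  have xK : x \notin K.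
    by apply/negP => /(subsetP KA); rewrite inE eirr andbF.
  apply: (freeS (x |: K)); last by rewrite cardsU1 xK cK.
    by rewrite subUset sub1set xS (subset_trans KA AS).
  move=> a b; rewrite !inE => /orP[/eqP->|aK] /orP[/eqP->|bK].
  - by rewrite eqxx.
  - by have := subsetP KA _ bK; rewrite inE => /andP[].
  - by rewrite esym; have := subsetP KA _ aK; rewrite inE => /andP[].
  - exact: Kc.
have splitS F : \sum_(y in S) F y = \sum_(y in A) F y + \sum_(y in S :\: A) F y.
  by rewrite (big_setID A) /= (setIidPr AS).
have outer : \sum_(y in S :\: A) deg y <= (#|S| - deg x) * deg x.
  rewrite -cardA -(cardsDS AS) cardA -sum_nat_const.
  by apply: leq_sum => y /setDP[yS _]; apply: xmax.
have inner : \sum_(y in A) deg y <=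
    \sum_(y in A) \sum_(z in A) e y z + \sum_(y in S :\: A) deg y.
  under eq_bigr do rewrite /deg splitS.
  rewrite big_split leq_add2l /= exchange_big /=; apply: leq_sum => z _.
  rewrite /deg splitS; apply: leq_trans (leq_addr _ _); apply: leq_sum => y _.
  by rewrite esym.
have -> : \sum_(y in S) \sum_(z in S) e y z =
    \sum_(y in A) deg y + \sum_(y in S :\: A) deg y by rewrite -splitS.
have dS : deg x <= #|S| by rewrite -cardA subset_leq_card.
rewrite -(subnKC dS); exact: turan_step IHA outer inner.
Qed.

(** With A the sum of a over P and q = |P|, this sums
    2 (q a_i) A <= (q a_i)^2 + A^2 over P. *)
Lemma cauchy_schwarz_card (I : finType) (P : {set I}) (a : I -> nat) :
  (\sum_(i in P) a i) ^ 2 <= #|P| * \sum_(i in P) a i ^ 2.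
Proof.
set A := \sum_(i in P) a i; set B := \sum_(i in P) _; set q := #|P|.
have [/cards0_eq P0|q0] := posnP q; first by rewrite /A P0 big_set0.
have: \sum_(i in P) 2 * ((q * a i) * A) <= \sum_(i in P) ((q * a i) ^ 2 + A ^ 2).
  by apply: leq_sum => i _; exact: nat_Cauchy.
rewrite [leqRHS]big_split sum_nat_const.
rewrite [X in _ <= X + _ -> _](eq_bigr _ (fun i _ => expnMn q (a i) 2)).
rewrite -!big_distrr -big_distrl -big_distrr /= -/A -/B -/q => h.
by rewrite -(leq_pmul2l q0); nia.
Qed.

(** * Cancellation in terms of ordered triples *)

Definition triple (T : finType) (H : {set {set T}}) (x y z : T) : bool :=
  [set x; y; z] \in H.

(** For a 3-graph H and x in W, twice the degree of x in the subgraph induced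
    on W. *)
Definition links (T : finType) (H : {set {set T}}) (W : {set T}) (x : T) : nat :=
  \sum_(y in W) \sum_(z in W) triple H x y z.

(** For a 3-graph H, six times the number of edges inside W. *)
Definition triples (T : finType) (H : {set {set T}}) (W : {set T}) : nat :=
  \sum_(x in W) links H W x.

Definition shadow (T : finType) (H : {set {set T}}) : rel T :=
  fun x y => [exists z, triple H x y z].

Definition codeg_set (T : finType) (H : {set {set T}}) (x y : T) : {set T} :=
  [set z | triple H x y z].

Lemma tripleC12 (T : finType) (H : {set {set T}}) x y z :
  triple H x y z = triple H y x z.
Proof. by rewrite /triple (setUC [set x]). Qed.

Lemma tripleC23 (T : finType) (H : {set {set T}}) x y z :
  triple H x y z = triple H x z y.
Proof. by rewrite /triple -!setUA (setUC [set y]). Qed.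

Lemma triple_neq (T : finType) (H : {set {set T}}) x y z :
  three_graph H -> triple H x y z -> x != y.
Proof.
move=> H3 /H3 h; apply/eqP=> xy; move: h; rewrite xy setUid cards2.
by case: (_ != _).
Qed.

Lemma shadow_sym (T : finType) (H : {set {set T}}) : symmetric (shadow H).
Proof. by move=> x y; apply: eq_existsb => z; rewrite tripleC12. Qed.

Lemma shadow_irr (T : finType) (H : {set {set T}}) :
  three_graph H -> irreflexive (shadow H).
Proof.
move=> H3 x; apply/negbTE/existsP=> -[z] /(triple_neq H3).
by rewrite eqxx.
Qed.

(** xuv and yuv have symmetric difference {x, y}, which no third edge may
    contain; an edge xyz would differ from both, as neither contains
    both x and y. *)
Lemma cancel_triples (T : finType) (H : {set {set T}}) x y u v :
    three_graph H -> cancellative H ->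
  triple H x u v -> triple H y u v -> shadow H x y = false.
Proof.
move=> H3 cH xuv yuv; apply/negbTE/existsP=> -[z xyz].
have xy := triple_neq H3 xyz.
have xu := triple_neq H3 xuv; have yu := triple_neq H3 yuv.
have xv : x != v by rewrite tripleC23 in xuv; exact: triple_neq xuv.
have yv : y != v by rewrite tripleC23 in yuv; exact: triple_neq yuv.
have neq (a : T) (A B : {set T}) : a \in A -> a \notin B -> A != B.
  by move=> aA aB; apply: contraNneq aB => <-.
have /negP[] : ~~ (symdiff [set x; u; v] [set y; u; v] \subset [set x; y; z]).
  apply: cH => //.
  - by apply: (neq x); rewrite !inE ?eqxx // !negb_or xy xu.
  - by rewrite eq_sym; apply: (neq y); rewrite !inE ?eqxx ?orbT // !negb_or eq_sym xy yu.
  - by rewrite eq_sym; apply: (neq x); rewrite !inE ?eqxx // !negb_or xy xu.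
apply/subsetP=> w; rewrite !inE.
by case: (w == x); case: (w == y); case: (w == u); case: (w == v).
Qed.

Lemma edge_triple (T : finType) (A : {set T}) x y :
  #|A| = 3 -> x \in A -> y \in A -> x != y -> exists z, A = [set x; y; z].
Proof.
move=> A3 xA yA xy.
have : #|A :\ x :\ y| == 1.
  have := cardsD1 y (A :\ x); have := cardsD1 x A.
  by rewrite A3 xA !inE eq_sym xy yA; lia.
case/cards1P=> z Az; exists z.
by rewrite -setUA -Az setD1K ?setD1K // !inE eq_sym xy.
Qed.

Lemma edges_triples (T : finType) (H : {set {set T}}) :
  three_graph H -> 6 * #|H| <= triples H setT.
Proof.
move=> H3; have -> : triples H setT =
    \sum_(A in H) \sum_(x : T) \sum_(y : T) \sum_(z : T) ([set x; y; z] == A).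
  rewrite /triples /links [RHS]exchange_big big_mkcond.
  apply: eq_bigr => x _; rewrite inE [RHS]exchange_big big_mkcond.
  apply: eq_bigr => y _; rewrite inE [RHS]exchange_big big_mkcond.
  apply: eq_bigr => z _; rewrite inE.
  rewrite /triple; have [xyz|xyz] := boolP (_ \in H).
    rewrite (bigD1 [set x; y; z]) //= eqxx big1 // => A /andP[_ /negbTE].
    by rewrite eq_sym => ->.
  by rewrite big1 // => A AH; apply/eqP; rewrite eqb0; apply: contraNneq xyz => ->.
(* An edge has 3 choices of x, then 2 of y, then 1 of z. *)
rewrite mulnC -sum_nat_const; apply: leq_sum => A /H3 A3.
have -> : 6 = \sum_(x in A) 2 by rewrite sum_nat_const A3.
rewrite big_mkcond; apply: leq_sum => x _; case: ifP => // xA.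
have A2 : #|A :\ x| = 2 by have := cardsD1 x A; rewrite xA A3; lia.
have -> : 2 = \sum_(y in A :\ x) 1 by rewrite sum_nat_const A2.
rewrite big_mkcond; apply: leq_sum => y _; case: ifP => // yAx.
have [xy yA] : x != y /\ y \in A by move: yAx; rewrite !inE eq_sym => /andP.
have [z Az] := edge_triple A3 xA yA xy.
by rewrite (bigD1 z) //= Az eqxx.
Qed.

(** Two vertices of K with yz in their links could not be covered. *)
Lemma sum_clique_triple (T : finType) (H : {set {set T}}) (K : {set T}) y z :
    three_graph H -> cancellative H -> clique (shadow H) K ->
  \sum_(x in K) triple H x y z <= shadow H y z.
Proof.
move=> H3 cH cK; case: (pickP [pred x in K | triple H x y z]) => [x|none].
  case/andP=> /= xK xyz; rewrite (bigD1 x) //= xyz big1 => [|x' /andP[x'K x'x]].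
    suff -> : shadow H y z by [].
    by apply/existsP; exists x; rewrite tripleC23 tripleC12.
  case x'yz: (triple H x' y z) => //.
  by have := cK _ _ x'K xK x'x; rewrite (cancel_triples H3 cH x'yz xyz).
by rewrite big1 // => x xK; have := none x; rewrite /= xK /= => ->.
Qed.

(** * Large links leave few covered pairs *)

(** The disjoint links of the vertices of K all consist of covered pairs. *)
Lemma clique_shadow (T : finType) (H : {set {set T}}) (W K : {set T}) :
    three_graph H -> cancellative H ->
    (forall x, x \in W -> #|W| ^ 2 < 5 * links H W x) ->
    K \subset W -> clique (shadow H) K -> 0 < #|K| ->
  #|K| * #|W| ^ 2 < 5 * (\sum_(y in W) \sum_(z in W) shadow H y z).
Proof.
move=> H3 cH hW KW cK K0.
have low : #|K| * (#|W| ^ 2).+1 <= 5 * (\sum_(x in K) links H W x).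
  rewrite -sum_nat_const big_distrr; apply: leq_sum => x xK.
  exact/hW/(subsetP KW).
have up : \sum_(x in K) links H W x <= \sum_(y in W) \sum_(z in W) shadow H y z.
  rewrite exchange_big; apply: leq_sum => y _.
  rewrite exchange_big; apply: leq_sum => z _.
  exact: sum_clique_triple.
by move: low up; lia.
Qed.

(** The trivial bound m^2 on ordered covered pairs excludes K_5, as 5/5 >= 1;
    this improves the bound to 3/4 m^2, which excludes K_4, as 4/5 >= 3/4. *)
Lemma shadow_bound (T : finType) (H : {set {set T}}) (W : {set T}) :
    three_graph H -> cancellative H ->
    (forall x, x \in W -> #|W| ^ 2 < 5 * links H W x) ->
  3 * (\sum_(y in W) \sum_(z in W) shadow H y z) <= 2 * #|W| ^ 2.
Proof.
move=> H3 cH hW.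
have sh1 : \sum_(y in W) \sum_(z in W) shadow H y z <= #|W| ^ 2.
  rewrite -mulnn -{1}sum1_card big_distrl /=; apply: leq_sum => y _.
  by rewrite mul1n -sum1_card; apply: leq_sum => z _; apply: leq_b1.
have sh3 : 4 * (\sum_(y in W) \sum_(z in W) shadow H y z) <= 3 * #|W| ^ 2.
  apply: turan => [||K KW cK K5]; [exact: shadow_sym|exact: shadow_irr|].
  by have := clique_shadow H3 cH hW KW cK; rewrite K5; lia.
apply: turan => [||K KW cK K4]; [exact: shadow_sym|exact: shadow_irr|].
by have := clique_shadow H3 cH hW KW cK; rewrite K4; lia.
Qed.

(** * Deleting vertices with a small link *)

Lemma leq_sum_setD1 (T : finType) (W : {set T}) x (F : T -> nat) :
  \sum_(a in W :\ x) F a <= \sum_(a in W) F a.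
Proof.
rewrite big_mkcond [leqRHS]big_mkcond; apply: leq_sum => a _.
by rewrite !inE; case: (_ != _); case: (_ \in _).
Qed.

Lemma triplesD1 (T : finType) (H : {set {set T}}) (W : {set T}) x :
  x \in W -> triples H W <= triples H (W :\ x) + 3 * links H W x.
Proof.
move=> xW; rewrite /triples (big_setD1 x) //= addnC mulSn [_ + 2 * _]addnC addnA.
rewrite leq_add2r.
have -> : \sum_(a in W :\ x) links H W a =
    \sum_(a in W :\ x) (\sum_(c in W) triple H a x c +
    (\sum_(b in W :\ x) triple H a b x + links H (W :\ x) a)).
  apply: eq_bigr => a _; rewrite /links (big_setD1 x) //=; congr (_ + _).
  by rewrite -big_split; apply: eq_bigr => b _; rewrite (big_setD1 x).
rewrite !big_split /= addnA addnC leq_add2l mul2n -addnn; apply: leq_add.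
  apply: leq_trans (leq_sum_setD1 _ _ _) _; rewrite /links.
  by apply: leq_sum => a _; apply: leq_sum => c _; rewrite tripleC12.
apply: leq_trans (leq_sum_setD1 _ _ _) _; rewrite /links.
apply: leq_sum => a _; apply: leq_trans (leq_sum_setD1 _ _ _) _.
by apply: leq_sum => c _; rewrite tripleC23 tripleC12.
Qed.

(** Deleting a vertex with links H W x <= m^2 / 5 destroys at most 3 m^2 / 5
    ordered triples.  The potential m^3 + 3 m^2 decreases by
    3 m^2 + 3 m - 2 >= 3 m^2 when m drops by one, the lower-order term
    absorbing the difference between m^3 - (m - 1)^3 and 3 m^2. *)
Lemma dense_core (T : finType) (H : {set {set T}}) (W : {set T}) :
  exists2 W' : {set T},
    forall x, x \in W' -> #|W'| ^ 2 < 5 * links H W' x &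
    #|W'| <= #|W| /\
    5 * triples H W + (#|W'| ^ 3 + 3 * #|W'| ^ 2) <=
    5 * triples H W' + (#|W| ^ 3 + 3 * #|W| ^ 2).
Proof.
have [m] := ubnP #|W|; elim: m W => // m IHm W Wm.
have [/forallP hW|] := boolP [forall x in W, #|W| ^ 2 < 5 * links H W x].
  by exists W => // x xW; have := hW x; rewrite xW.
rewrite negb_forall_in => /exists_inP[x xW]; rewrite -leqNgt => low.
have cW : #|W| = #|W :\ x|.+1 by rewrite (cardsD1 x W) xW.
have [|W' hW' [W'W tW']] := IHm (W :\ x); first by rewrite -cW -ltnS.
exists W' => //; split; first by rewrite cW ltnW.
have := triplesD1 H xW; move: low tW'; rewrite cW; nia.
Qed.

(** * Independent sets from a heavy edge *)

Definition strongly_independent (T : finType) (H : {set {set T}}) (V : {set T}) :=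
  forall A, A \in H -> #|A :&: V| <= 1.

(** Two vertices of N(xy) form triples with the same pair xy, hence are not
    covered. *)
Lemma codeg_set_independent (T : finType) (H : {set {set T}}) x y :
  three_graph H -> cancellative H -> strongly_independent H (codeg_set H x y).
Proof.
move=> H3 cH A AH; apply/card_le1_eqP => u v /setIP[uA]; rewrite inE => xyu.
case/setIP=> vA; rewrite inE => xyv; apply/eqP; apply: contraT; rewrite eq_sym => uv.
have [w Aw] := edge_triple (H3 _ AH) uA vA uv.
have: shadow H u v by apply/existsP; exists w; rewrite /triple -Aw.
by rewrite (@cancel_triples _ _ u v x y) // tripleC12 tripleC23.
Qed.

(** A common vertex w would give the edges ywx and zwx although yz is covered. *)
Lemma codeg_set_disjoint (T : finType) (H : {set {set T}}) x y z :
    three_graph H -> cancellative H -> shadow H y z ->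
  [disjoint codeg_set H x y & codeg_set H x z].
Proof.
move=> H3 cH yz; apply/pred0P=> w /=; rewrite !inE; apply/andP=> -[xyw xzw].
rewrite tripleC12 in xyw; rewrite tripleC12 in xzw.
by rewrite (cancel_triples H3 cH xyw xzw) in yz.
Qed.

(** Let d be the codegree in W, P the set of ordered covered pairs, t the number
    of ordered triples and Q the sum of d^2 over P.  Summing
    d(xy) + d(yz) + d(zx) over the ordered triples gives 3 Q, so its maximum s
    satisfies 3 Q <= t s; since t is the sum of d over P, t^2 <= |P| Q.
    Together, 3 t <= |P| s. *)
Lemma heavy_edge (T : finType) (H : {set {set T}}) (W : {set T}) :
    three_graph H -> cancellative H ->
    3 * (\sum_(y in W) \sum_(z in W) shadow H y z) <= 2 * #|W| ^ 2 ->
  triples H W = 0 \/ exists x y z, triple H x y z /\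
    9 * triples H W <= 2 * #|W| ^ 2 *
     (#|codeg_set H x y :&: W| + #|codeg_set H y z :&: W| + #|codeg_set H z x :&: W|).
Proof.
move=> H3 cH hsh.
pose E := triple H; pose d x y := #|codeg_set H x y :&: W|.
have dE x y : d x y = \sum_(z in W) E x y z.
  rewrite /d -sum1_card big_mkcond [RHS]big_mkcond; apply: eq_bigr => z _.
  by rewrite !inE andbC /E; case: (z \in W) => //; case: (triple _ _ _ _).
pose P := [set p : T * T | [&& p.1 \in W, p.2 \in W & shadow H p.1 p.2]].
have sumP (F : T -> T -> nat) : (forall x y, ~~ shadow H x y -> F x y = 0) ->
    \sum_(x in W) \sum_(y in W) F x y = \sum_(p in P) F p.1 p.2.
  move=> F0; rewrite pair_big /= big_mkcond [RHS]big_mkcond; apply: eq_bigr => p _.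
  rewrite !inE andbA; case: (_ && _) => //=.
  by have [|/F0] := boolP (shadow H p.1 p.2).
have d0 x y : ~~ shadow H x y -> d x y = 0.
  move=> xy; rewrite dE big1 // => z _; apply/eqP; rewrite eqb0.
  by apply: contra xy => xyz; apply/existsP; exists z.
have cardP : #|P| = \sum_(x in W) \sum_(y in W) shadow H x y.
  rewrite (sumP (fun x y => shadow H x y : nat)) => [|x y /negbTE -> //].
  rewrite -sum1_card; apply: eq_bigr => p; rewrite inE.
  by case/and3P=> _ _ ->.
have tE : triples H W = \sum_(p in P) d p.1 p.2.
  rewrite -sumP //; apply: eq_bigr => x _; apply: eq_bigr => y _.
  by rewrite dE.
pose Q := \sum_(p in P) d p.1 p.2 ^ 2.
have QE : Q = \sum_(x in W) \sum_(y in W) \sum_(z in W) E x y z * d x y.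
  rewrite /Q -(sumP (fun x y => d x y ^ 2)) => [|x y /d0 -> //].
  apply: eq_bigr => x _; apply: eq_bigr => y _.
  by rewrite -big_distrl /= -dE mulnn.
have CS : triples H W ^ 2 <= #|P| * Q by rewrite tE; exact: cauchy_schwarz_card.
pose f x y z := d x y + d y z + d z x.
have sumf : \sum_(x in W) \sum_(y in W) \sum_(z in W) E x y z * f x y z = 3 * Q.
  pose G x y z := E x y z * d x y.
  have Q2 : \sum_(x in W) \sum_(y in W) \sum_(z in W) G y z x = Q.
    rewrite exchange_big QE; apply: eq_bigr => y _.
    by rewrite exchange_big.
  have Q3 : \sum_(x in W) \sum_(y in W) \sum_(z in W) G z x y = Q.
    under eq_bigr do rewrite exchange_big.
    by rewrite exchange_big QE.
  rewrite !mulSn addn0 {1}QE -{1}Q2 -Q3 -!big_split; apply: eq_bigr => x _.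
  rewrite -!big_split; apply: eq_bigr => y _.
  rewrite -!big_split; apply: eq_bigr => z _ /=.
  have yzx : E y z x = E x y z by rewrite /E tripleC23 tripleC12.
  have zxy : E z x y = E x y z by rewrite /E tripleC12 tripleC23.
  by rewrite /G /f yzx zxy !mulnDr addnA.
pose tE3 := fun t : T * T * T => E t.1.1 t.1.2 t.2.
case: (pickP tE3) => [t0 t0E|none]; last first.
  left; apply: big1 => x _; apply: big1 => y _; apply: big1 => z _.
  by have := none (x, y, z); rewrite /tE3 /E /= => ->.
case: (@arg_maxnP _ t0 tE3 (fun t => f t.1.1 t.1.2 t.2) t0E) => -[[x y] z] /= xyz fmax.
have [|t0'] := posnP (triples H W); [by left|right]; exists x, y, z; split=> //.
change (9 * triples H W <= 2 * #|W| ^ 2 * f x y z).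
have : 3 * Q <= triples H W * f x y z.
  rewrite -sumf big_distrl; apply: leq_sum => a _.
  rewrite big_distrl; apply: leq_sum => b _.
  rewrite big_distrl; apply: leq_sum => c _ /=.
  rewrite -/E; case abc: (E a b c) => //; rewrite !mul1n.
  exact: (fmax (a, b, c)).
move: hsh; rewrite -cardP => hP hQ.
rewrite -(leq_pmul2l t0'); nia.
Qed.

(** * The tripartition *)

Lemma card_edges_meeting (T : finType) (H : {set {set T}}) (M : {set T}) :
  three_graph H -> #|[set e in H | e :&: M != set0]| <= #|M| * #|T| ^ 2.
Proof.
move=> H3.
have -> : #|M| * #|T| ^ 2 = #|setX (setX M [set: T]) [set: T]|.
  by rewrite !cardsX !cardsT -mulnn mulnA.
pose F (t : T * T * T) := [set t.1.1; t.1.2; t.2].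
apply: leq_trans (leq_imset_card F _); apply/subset_leq_card/subsetP=> e.
rewrite inE => /andP[eH /set0Pn[x /setIP[xe xM]]].
have e3 := H3 _ eH.
have /card_gt0P[y] : 0 < #|e :\ x| by have := cardsD1 x e; rewrite xe e3; lia.
rewrite !inE eq_sym => /andP[xy ye].
have [z ->] := edge_triple e3 xe ye xy.
by apply/imsetP; exists (x, y, z); rewrite // !inE xM.
Qed.

Lemma card_disjointU3 (T : finType) (A B C : {set T}) :
    [disjoint A & B] -> [disjoint B & C] -> [disjoint C & A] ->
  #|A :|: B :|: C| = #|A| + #|B| + #|C|.
Proof.
move=> dAB dBC dCA; rewrite cardsU cardsU (disjoint_setI0 dAB) cards0 subn0.
rewrite setIUl [A :&: C]setIC (disjoint_setI0 dCA) (disjoint_setI0 dBC).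
by rewrite setU0 cards0 subn0.
Qed.

(** The vertices outside A, B and C join the part of A.  An edge without such
    vertices meets each part at most once, hence exactly once. *)
Lemma independent_tripartition (T : finType) (H : {set {set T}}) (A B C : {set T}) :
    three_graph H ->
    strongly_independent H A -> strongly_independent H B -> strongly_independent H C ->
    [disjoint A & B] -> [disjoint B & C] -> [disjoint C & A] ->
  exists V : 'I_3 -> {set T}, tripartition V /\
    #|noncrossing V H| + (#|A| + #|B| + #|C|) * #|T| ^ 2 <= #|T| ^ 3.
Proof.
move=> H3 iA iB iC dAB dBC dCA.
pose V (i : 'I_3) :=
  if i == 0 :> nat then ~: (B :|: C) else if i == 1 :> nat then B else C.
have tV : tripartition V.
  split=> [i j ij|].
    apply/pred0P=> x /=; have := pred0P dBC x; move: ij; rewrite /V /= -val_eqE /=.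
    case: i j => [[|[|[|i]]] //= _] [[|[|[|j]]] //= _] _; rewrite ?inE;
    by case: (x \in B); case: (x \in C).
  apply/setP=> x; rewrite inE; apply/bigcupP.
  have [xB|xB] := boolP (x \in B); first by exists (inord 1); rewrite // /V inordK.
  have [xC|xC] := boolP (x \in C); first by exists (inord 2); rewrite // /V inordK.
  by exists ord0; rewrite // /V /= !inE negb_or xB.
exists V; split=> //.
pose M := ~: (A :|: B :|: C).
have : #|noncrossing V H| <= #|M| * #|T| ^ 2.
  apply: leq_trans (card_edges_meeting M H3); apply/subset_leq_card/subsetP=> e.
  rewrite !inE => /andP[eH]; rewrite eH /=; apply: contra => /eqP eM.
  suff eV : e \in partial_transversals V.
    by apply/forallP=> i; apply/eqP; exact: partial_transversal_crossing eV i.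
  rewrite inE (H3 _ eH) eqxx /=; apply/forallP=> i; rewrite /V.
  case: ifP => _; last by case: ifP => _; [exact: iB|exact: iC].
  apply: leq_trans (iA _ eH); apply/subset_leq_card/subsetP=> x.
  rewrite !inE => /andP[xe]; move/setP/(_ x): eM; rewrite !inE xe /=.
  by case: (x \in A); case: (x \in B); case: (x \in C).
have cU := card_disjointU3 dAB dBC dCA.
have := cardsC (A :|: B :|: C); rewrite -/M cU expnS; nia.
Qed.

(** Here s is the number of vertices in the three independent sets.  With m the
    size of the dense core, 270 |H| <= 10 m^2 s + 9 (n^3 + 3 n^2) - 9 m^3, and
    s <= m turns 10 m^2 s - 9 m^3 into at most m^2 s. *)
Lemma cancellative_tripartition (T : finType) (H : {set {set T}}) :
    three_graph H -> cancellative H ->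
  exists (V : 'I_3 -> {set T}) (s : nat), [/\ tripartition V,
    #|noncrossing V H| + s * #|T| ^ 2 <= #|T| ^ 3 &
    270 * #|H| <= s * #|T| ^ 2 + 9 * (#|T| ^ 3 + 3 * #|T| ^ 2)].
Proof.
move=> H3 cH.
have [W hW []] := dense_core H setT; rewrite cardsT => Wn tW.
have t6 := edges_triples H3.
suff [A [B [C [[iA iB iC] [dAB dBC dCA] sW sT]]]] : exists A B C : {set T}, [/\
    [/\ strongly_independent H A, strongly_independent H B & strongly_independent H C],
    [/\ [disjoint A & B], [disjoint B & C] & [disjoint C & A]],
    #|A| + #|B| + #|C| <= #|W| &
    9 * triples H W <= 2 * #|W| ^ 2 * (#|A| + #|B| + #|C|)].
  have [V [tV nV]] := independent_tripartition H3 iA iB iC dAB dBC dCA.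
  exists V, (#|A| + #|B| + #|C|); split=> //.
  move: sW sT tW t6 Wn; move: (#|A| + _ + _) (triples H W) (triples H setT) #|H| #|W| #|T|.
  move=> s t tt h m n sm ht htt h6 mn.
  have : m ^ 2 * s <= n ^ 2 * s by rewrite leq_mul2r leq_sqr mn orbT.
  have : m ^ 2 * s <= m ^ 3 by rewrite (expnSr m 2) leq_mul2l sm orbT.
  by move: ht htt; rewrite -mulnA; lia.
have [t0|[x [y [z [xyz hs]]]]] := heavy_edge H3 cH (shadow_bound H3 cH hW).
  exists set0, set0, set0; rewrite t0 cards0; split=> //.
    by split=> e _; rewrite setI0 cards0.
  by split; rewrite -setI_eq0 set0I.
have indep u v : strongly_independent H (codeg_set H u v :&: W).
  move=> e /(codeg_set_independent u v H3 cH); apply: leq_trans.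
  by apply/subset_leq_card/setIS/subsetIl.
have disj u v w : triple H u v w ->
    [disjoint codeg_set H u v :&: W & codeg_set H v w :&: W].
  move=> uvw; apply: disjointW (subsetIl _ _) (subsetIl _ _) _.
  have -> : codeg_set H u v = codeg_set H v u.
    by apply/setP=> a; rewrite !inE tripleC12.
  apply: codeg_set_disjoint => //; apply/existsP; exists v.
  by rewrite tripleC23.
have yzx : triple H y z x by rewrite tripleC23 tripleC12.
have zxy : triple H z x y by rewrite tripleC12 tripleC23.
exists (codeg_set H x y :&: W), (codeg_set H y z :&: W), (codeg_set H z x :&: W).
have [dAB dBC dCA] := And3 (disj _ _ _ xyz) (disj _ _ _ yzx) (disj _ _ _ zxy).
split=> //.
by rewrite -card_disjointU3 // subset_leq_card // !subUset !subsetIr.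
Qed.

Lemma t3_lower n : n ^ 3 <= 27 * t3 n + 6 * n ^ 2.
Proof.
rewrite /t3 (card_partial_transversals (@residue_parts_tripartition n)).
have part i : n %/ 3 <= #|residue_parts n i|.
  by have := residue_parts_balanced n i; rewrite card_ord => -[] ->; lia.
have : (n %/ 3) ^ 3 <= \prod_i #|residue_parts n i|.
  have -> : (n %/ 3) ^ 3 = \prod_(i < 3) (n %/ 3) by rewrite prod_nat_const card_ord.
  by apply: leq_prod => i _; exact: part.
move: (\prod_i _) => P.
have := ltn_pmod n (isT : 0 < 3); have := divn_eq n 3.
by move: (n %/ 3) (n %% 3) => k r -> r3; nia.
Qed.

Local Open Scope ring_scope.
Import Order.TTheory GRing.Theory Num.Theory.

Theorem mainTheorem2 (R : realType) (delta : R) (hdelta : 0 < delta) :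
  exists n0 : nat, forall n : nat, (n0 <= n)%N ->
  forall H : {set {set 'I_n}},
    three_graph H -> cancellative H ->
    (1 - delta / 100%:R) * (t3 n)%:R <= #|H|%:R :> R ->
    exists V : 'I_3 -> {set 'I_n},
      tripartition V /\ #|noncrossing V H|%:R <= delta * n%:R ^+ 3.
Proof.
(* The count of edges that are not crossing is at most delta n^3 / 10 + 87 n^2,
   where 87 = 10 * 6 + 9 * 3 collects the quadratic terms of [t3_lower] and
   [cancellative_tripartition]; n >= 97 / delta absorbs them. *)
exists (Num.bound (97%:R / delta)) => n n0n H H3 cH hH.
have [V [s [tV]]] := cancellative_tripartition H3 cH; rewrite card_ord => nV hs.
exists V; split=> //.
have large : 97%:R <= delta * n%:R.
  rewrite mulrC -ler_pdivrMr //; apply: le_trans (_ : (Num.bound (97%:R / delta))%:R <= _).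
    by apply/ltW/archi_boundP; rewrite divr_ge0 // ltW.
  by rewrite ler_nat.
move: nV hs (t3_lower n).
rewrite -!(ler_nat R) !(natrD, natrM, natrX).
move: hH large; move: (#|H|%:R) (#|noncrossing V H|%:R) (t3 n)%:R s%:R (ler0n R n) (ler0n R s).
move: (n%:R : R) => N h c t S N0 S0 hH large cS hS ht.
have N2 : 0 <= N ^+ 2 by rewrite exprn_ge0.
have N3 : 0 <= N ^+ 3 by rewrite exprn_ge0.
have large2 : 97%:R * N ^+ 2 <= delta * N ^+ 3.
  by rewrite [N ^+ 3]exprS mulrA ler_wpM2r.
have SN : 0 <= S * N ^+ 2 by rewrite mulr_ge0.
(* A large delta makes the claim trivial, and 1 - delta / 100 may be negative. *)
have [d1|d1] := leP 1 delta.
  have : N ^+ 3 <= delta * N ^+ 3 by rewrite ler_peMl.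
  by lra.
have e0 : 0 <= 1 - delta / 100%:R by lra.
have := ler_wpM2l e0 ht.
have : 0 <= delta * N ^+ 2 by rewrite mulr_ge0 // ltW.
move: (N ^+ 2) (N ^+ 3) N2 N3 large2 SN cS hS => a b *.
nra.
Qed.
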